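(* Let $Q$ be a finite quiver with vertex set $I$, $\Theta\in(\mathbf{Q}I)^*$ a stability condition, and $d\in\mathbf{N}I$ a nonzero dimension vector. For large enough $n\in\mathbf{N}I$ (in fact, for all $n$ with $n_i\geq d_i$ for all $i\in I$), the smooth model $M_{d,n}^\Theta(Q)$ is non-empty if and only if $M_d^{\rm sst}(Q)$ is non-empty.
   Context: Representations are over $\mathbf{C}$. For $0\ne d\in\mathbf{N}I$ put $\dim d=\sum_i d_i$, $\mu(d)=\Theta(d)/\dim d$; the slope of a nonzero representation is that of its dimension vector. A nonzero representation $X$ is semistable (resp. stable) if $\mu(U)\le\mu(X)$ (resp. $<$) for all nonzero proper subrepresentations $U$; it is polystable if it is a direct sum of stable representations of the same slope. $M_d^{\rm sst}(Q)$ is King's GIT moduli space parametrizing isomorphism classes of polystable representations of dimension vector $d$ (non-empty iff a semistable representation of dimension vector $d$ exists), and $M_d^{\rm st}(Q)$ is its open subset of stable representations. Smooth model: $\hat Q$ is obtained from $Q$ by adding a vertex $\infty$ and $n_i$ arrows $\infty\to i$ for each $i\in I$; $\hat d_i=d_i$ ($i\in I$), $\hat d_\infty=1$; $\hat\Theta_i=\Theta_i$ ($i\in I$), $\hat\Theta_\infty=\mu(d)+\varepsilon$ with $\varepsilon\in\mathbf{Q}$ positive and sufficiently small. Then $M_{d,n}^\Theta(Q):=M_{\hat d}^{\rm st}(\hat Q)$, with stability defined by $\hat\Theta$. *)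

(* Defs.v *)
From HB Require Import structures.
From mathcomp Require Import all_boot all_order all_algebra.

Set Implicit Arguments.
Unset Strict Implicit.
Unset Printing Implicit Defensive.

Import Order.TTheory GRing.Theory Num.Theory.

Local Open Scope ring_scope.

Record quiver := Quiver {
  vertex : finType;
  arrow : finType;
  src : arrow -> vertex;
  tgt : arrow -> vertex }.

Definition dimvec (Q : quiver) := {ffun vertex Q -> nat}.

(* A functional on QI is given by its values on the standard basis of QI. *)
Definition stability (Q : quiver) := vertex Q -> rat.

Definition theta (Q : quiver) (Theta : stability Q) (d : dimvec Q) : rat :=
  \sum_(i : vertex Q) Theta i * (d i)%:R.

Definition total_dim (Q : quiver) (d : dimvec Q) : nat :=
  (\sum_(i : vertex Q) d i)%N.

Definition slope (Q : quiver) (Theta : stability Q) (d : dimvec Q) : rat :=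
  theta Theta d / (total_dim d)%:R.

Section Representations.
Variables (F : fieldType) (Q : quiver).

Record rep := Rep {
  rspace : vertex Q -> vectType F;
  rmap : forall a : arrow Q, 'Hom(rspace (src a), rspace (tgt a)) }.

Definition rdim (X : rep) : dimvec Q := [ffun i => \dim {: rspace X i}].

Definition rep_iso (X Y : rep) : Prop :=
  exists phi : forall i, 'Hom(rspace X i, rspace Y i),
    (forall i, bijective (phi i)) /\
    (forall a, (phi (tgt a) \o rmap X a = rmap Y a \o phi (src a))%VF).

Record subrep (X : rep) := Subrep {
  sspace :> forall i, {vspace rspace X i};
  sspaceP : forall a,
    (rmap X a @: sspace (src a) <= sspace (tgt a))%VS }.

(* The arrows act by the restrictions of the maps of X: by sspaceP the image
   already lies in U (tgt a), so that vsproj is there a mere coercion. *)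
Definition rep_of_subrep (X : rep) (U : subrep X) : rep :=
  @Rep (fun i => subvs_of (U i))
    (fun a => (linfun (vsproj (U (tgt a))) \o
                 (rmap X a \o linfun (@vsval _ _ (U (src a)))))%VF).

Definition proper_subrep (X : rep) (U : subrep X) : Prop :=
  exists i, U i != fullv.

Definition nonzero_rep (X : rep) : Prop := rdim X != 0.

Variable Theta : stability Q.

Definition rslope (X : rep) : rat := slope Theta (rdim X).

Definition semistable (X : rep) : Prop :=
  nonzero_rep X /\
  forall U : subrep X, nonzero_rep (rep_of_subrep U) -> proper_subrep U ->
    rslope (rep_of_subrep U) <= rslope X.

Definition stable (X : rep) : Prop :=
  nonzero_rep X /\
  forall U : subrep X, nonzero_rep (rep_of_subrep U) -> proper_subrep U ->
    rslope (rep_of_subrep U) < rslope X.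

Definition polystable (X : rep) : Prop :=
  nonzero_rep X /\
  exists (m : nat) (U : 'I_m -> subrep X),
    [/\ forall k, stable (rep_of_subrep (U k)),
        forall k l, rslope (rep_of_subrep (U k)) = rslope (rep_of_subrep (U l)),
        forall i, (\sum_(k < m) U k i)%VS = fullv
      & forall i, directv (\sum_(k < m) U k i)%VS].

End Representations.

(* A set of representations is a predicate: rep F Q lives in too large a
   universe to be an argument of classical_sets.set. *)
Definition iso_class (F : fieldType) (Q : quiver) (X : rep F Q) :
  rep F Q -> Prop := fun Y => rep_iso X Y.

(* A moduli space is given by its set of points, which are isomorphism classes
   of representations. *)
Definition moduli_points (F : fieldType) (Q : quiver) :=
  (rep F Q -> Prop) -> Prop.

Definition moduli_sst (F : fieldType) (Q : quiver) (Theta : stability Q)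
    (d : dimvec Q) : moduli_points F Q :=
  fun c => exists X : rep F Q,
    [/\ polystable Theta X, rdim X = d & c = iso_class X].

Definition moduli_st (F : fieldType) (Q : quiver) (Theta : stability Q)
    (d : dimvec Q) : moduli_points F Q :=
  fun c => exists X : rep F Q,
    [/\ stable Theta X, rdim X = d & c = iso_class X].

Arguments moduli_sst F {Q} Theta d.
Arguments moduli_st F {Q} Theta d.

Definition nonempty (F : fieldType) (Q : quiver) (M : moduli_points F Q) :
  Prop := exists c, M c.

(* The vertex infinity is None; the k-th added arrow infinity -> i is the
   pair (i, k). *)
Definition hat_quiver (Q : quiver) (n : dimvec Q) : quiver :=
  @Quiver (option (vertex Q)) (arrow Q + {i : vertex Q & 'I_(n i)})%type
    (fun a => match a with inl b => Some (src b) | inr _ => None end)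
    (fun a => match a with inl b => Some (tgt b) | inr p => Some (tag p) end).

Definition hat_dim (Q : quiver) (n d : dimvec Q) : dimvec (hat_quiver n) :=
  [ffun o : option (vertex Q) => if o is Some i then d i else 1%N].

Definition hat_theta (Q : quiver) (n : dimvec Q) (Theta : stability Q)
    (d : dimvec Q) (eps : rat) : stability (hat_quiver n) :=
  fun o : option (vertex Q) => if o is Some i then Theta i
                               else slope Theta d + eps.

Arguments hat_theta {Q} n Theta d eps.

Definition smooth_model (F : fieldType) (Q : quiver) (Theta : stability Q)
    (d n : dimvec Q) (eps : rat) : moduli_points F (hat_quiver n) :=
  moduli_st F (hat_theta n Theta d eps) (hat_dim n d).

Arguments smooth_model F {Q} Theta d n eps.

(* Main.v *)
(** Only finitely many slopes occur among dimension vectors e <= d, so for small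
    eps a stable representation of the framed quiver restricts to a semistable
    representation of Q: a subrepresentation, extended by 0 at infinity, has
    slope < mu(d) + eps / (dim d + 1), hence <= mu(d).  A Jordan-Hoelder
    filtration then gives a polystable representation of the same dimension
    vector.  Conversely, a polystable X is semistable; if n >= d, let the new
    arrows infinity -> i hit a basis of X_i.  A subrepresentation which is
    nonzero at infinity is then everything, and one which is zero at infinity
    has slope <= mu(d) < mu(d) + eps / (dim d + 1). *)

Require Import Defs.
From HB Require Import structures.
From mathcomp Require Import all_boot all_order all_algebra.
From mathcomp Require Import reals complex.
From mathcomp Require Import boolp.

Set Implicit Arguments.
Unset Strict Implicit.
Unset Printing Implicit Defensive.

Import Order.TTheory GRing.Theory Num.Theory.

Local Open Scope ring_scope.
Local Open Scope complex_scope.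

(** * Sums over an index set with one added point, and gaps in finite sets of rationals *)

Lemma big_option (R : Type) (idx : R) (op : Monoid.com_law idx) (T : finType)
    (G : option T -> R) :
  \big[op/idx]_(o : option T) G o =
  op (G None) (\big[op/idx]_(i : T) G (Some i)).
Proof.
rewrite (bigD1 None) //=; congr (op _ _).
rewrite (reindex_omap Some id) /=; last by case.
by apply: eq_bigl => i; rewrite eqxx.
Qed.

Lemma exists_gap (s : seq rat) :
  exists2 e : rat, 0 < e & forall x, x \in s -> 0 < x -> e <= x.
Proof.
elim: s => [|y s [e e0 le_e]]; first by exists 1.
have [y0|y0] := ltP 0 y; last first.
  exists e => // x; rewrite inE => /orP[/eqP->|]; last exact: le_e.
  by rewrite ltNge y0.
exists (Num.min e y); first by rewrite lt_min e0.
move=> x; rewrite inE => /orP[/eqP-> _|xs x0]; rewrite ge_min ?lexx ?orbT //.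
by rewrite le_e.
Qed.

(** * Slope inequalities as sign conditions on an additive functional *)

Section Weight.
Variables (Q : quiver) (Theta : stability Q).
Implicit Types d e : dimvec Q.

Lemma total_dim_gt0 e : (0 < total_dim e)%N = (e != 0).
Proof.
rewrite lt0n; apply/idP/idP; apply: contraNneq => e0.
  by rewrite e0 /total_dim big1 // => i _; rewrite ffunE.
apply/eqP/ffunP => i; rewrite ffunE; apply/eqP.
by move/eqP: e0; rewrite sum_nat_eq0 => /forallP/(_ i).
Qed.

(** Clears the denominator of the slope: for nonzero [e] its sign is that of [slope Theta e - mu].
    Unlike the slope it is additive in [e] and harmless at [e = 0]. *)
Definition weight (mu : rat) e : rat := theta (fun i => Theta i - mu) e.

Lemma weightE mu e : weight mu e = theta Theta e - mu * (total_dim e)%:R.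
Proof.
rewrite /weight /theta /total_dim natr_sum mulr_sumr -sumrB.
by apply: eq_bigr => i _; rewrite mulrBl.
Qed.

Lemma weightD mu e e1 e2 : (forall i, e i = e1 i + e2 i)%N ->
  weight mu e = weight mu e1 + weight mu e2.
Proof.
move=> eD; rewrite /weight /theta -big_split.
by apply: eq_bigr => i _; rewrite eD natrD mulrDr.
Qed.

Lemma weight0 mu : weight mu 0 = 0.
Proof. by rewrite /weight /theta big1 // => i _; rewrite ffunE mulr0. Qed.

Lemma slope_subr mu e : e != 0 ->
  slope Theta e - mu = weight mu e / (total_dim e)%:R.
Proof.
rewrite -total_dim_gt0 => e0.
by rewrite weightE mulrBl mulfK // pnatr_eq0 -lt0n.
Qed.

Lemma slope_le mu e : e != 0 -> (slope Theta e <= mu) = (weight mu e <= 0).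
Proof.
move=> e0; rewrite -subr_le0 slope_subr // pmulr_lle0 //.
by rewrite invr_gt0 ltr0n total_dim_gt0.
Qed.

Lemma slope_lt mu e : e != 0 -> (slope Theta e < mu) = (weight mu e < 0).
Proof.
move=> e0; rewrite -subr_lt0 slope_subr // pmulr_llt0 //.
by rewrite invr_gt0 ltr0n total_dim_gt0.
Qed.

Lemma slope_eq mu e : e != 0 -> (slope Theta e == mu) = (weight mu e == 0).
Proof. by move=> e0; rewrite !eq_le slope_le // !leNgt slope_lt. Qed.

Lemma weight_slope e : e != 0 -> weight (slope Theta e) e = 0.
Proof. by move=> e0; apply/eqP; rewrite -slope_eq. Qed.

End Weight.

(** * Semistability and Jordan-Hoelder filtrations for invariant families of subspaces *)

Section Families.
Variables (F : fieldType) (Q : quiver) (Theta : stability Q).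
Variable V : vertex Q -> vectType F.
Notation maps := (forall a : arrow Q, 'Hom(V (src a), V (tgt a))).
Notation family := (forall i : vertex Q, {vspace V i}).
Implicit Types (f g : maps) (U W A B : family) (mu : rat).

(** Subrepresentations are handled as families of subspaces of fixed ambient spaces. Iterated
    subrepresentations then stay in the same type, and the arrow maps can be changed without
    changing the spaces. *)
Definition invariant f U := forall a u, u \in U (src a) -> f a u \in U (tgt a).

Definition fdim U : dimvec Q := [ffun i => \dim (U i)].

Lemma invariantP f U :
  (forall a, (f a @: U (src a) <= U (tgt a))%VS) <-> invariant f U.
Proof.
split=> [sU a u uU|iU a]; first exact: (subvP (sU a)) _ (memv_img _ uU).
by apply/subvP => w /memv_imgP[u uU ->]; apply: iU.
Qed.

Lemma invariant_cap f A B : invariant f A -> invariant f B ->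
  invariant f (fun i => A i :&: B i)%VS.
Proof.
by move=> iA iB a u; rewrite !memv_cap => /andP[uA uB]; rewrite iA ?iB.
Qed.

Lemma invariant_add f A B : invariant f A -> invariant f B ->
  invariant f (fun i => A i + B i)%VS.
Proof.
move=> iA iB a u /memv_addP[x xA [y yB ->]].
by rewrite linearD memv_add ?iA ?iB.
Qed.

Lemma fdim_eq0 U : (forall i, U i = 0%VS) <-> fdim U = 0.
Proof.
split=> [U0|/ffunP U0 i]; first by apply/ffunP => i; rewrite !ffunE U0 dimv0.
by apply/eqP; rewrite -dimv_eq0; have := U0 i; rewrite !ffunE => ->.
Qed.

Lemma total_fdim_lt U W : (forall i, U i <= W i)%VS ->
  (exists i, U i != W i) -> (total_dim (fdim U) < total_dim (fdim W))%N.
Proof.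
move=> sUW [i neUW]; rewrite /total_dim (bigD1 i) // [X in (_ < X)%N](bigD1 i) //=.
rewrite -addSn leq_add //.
  rewrite !ffunE ltn_neqAle dimvS // andbT.
  by rewrite (dimv_leqif_eq (sUW i)).
by apply: leq_sum => j _; rewrite !ffunE dimvS.
Qed.

(** The reference slope [mu] is a parameter. When [W] is nonzero, invariant and of weight 0, this is
    semistability of [W] with slope [mu]; the zero and full subfamilies then satisfy the inequality
    trivially. *)
Definition semistable_in mu f W :=
  forall U, invariant f U -> (forall i, U i <= W i)%VS ->
    weight Theta mu (fdim U) <= 0.

Definition stable_in mu f W :=
  [/\ invariant f W, fdim W != 0, weight Theta mu (fdim W) = 0
    & forall U, invariant f U -> (forall i, U i <= W i)%VS -> fdim U != 0 ->
        (exists i, U i != W i) -> weight Theta mu (fdim U) < 0].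

Lemma stable_in_semistable mu f W : stable_in mu f W -> semistable_in mu f W.
Proof.
case=> _ _ W0 sW U iU sUW.
have [U0|Un0] := eqVneq (fdim U) 0; first by rewrite U0 weight0.
case: (EM (exists i, U i != W i)) => [neUW|eqUW]; first exact/ltW/sW.
suff -> : fdim U = fdim W by rewrite W0.
apply/ffunP => i; rewrite !ffunE; case: (eqVneq (U i) (W i)) => [->//|ne].
by case: eqUW; exists i.
Qed.

Lemma eq_stable_in mu f g W :
  (forall a u, u \in W (src a) -> f a u = g a u) ->
  stable_in mu f W -> stable_in mu g W.
Proof.
move=> fg [iW Wn0 W0 sW]; split=> // [a u uW|U iU sUW].
  by rewrite -fg // iW.
apply: sW => // a u uU; rewrite fg ?iU //.
exact: (subvP (sUW _)).
Qed.

(** A subfamily [U] of the direct sum is an extension of its projection to [B] along [A], which is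
    [(A + U) :&: B], by [U :&: A]. Both pieces are invariant and their weights add up to that of
    [U]. *)
Lemma semistable_in_add mu f A B : invariant f A -> invariant f B ->
  (forall i, A i :&: B i = 0)%VS ->
  semistable_in mu f A -> semistable_in mu f B ->
  semistable_in mu f (fun i => A i + B i)%VS.
Proof.
move=> iA iB AB0 sA sB U iU sU.
rewrite (@weightD _ _ _ _ (fdim (fun i => U i :&: A i)%VS)
  (fdim (fun i => (A i + U i) :&: B i)%VS)); last first.
  move=> i; rewrite !ffunE.
  (* Since [U] lies in [A + B], the modular law splits [A + U] as [A] plus its part in [B].
     Comparing with the dimension formula for [A + U] and cancelling [dim A] gives the claim. *)
  have eqAU : (A i + U i = A i + (A i + U i) :&: B i)%VS.
    apply/eqP; rewrite eqEsubv; apply/andP; split; last first.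
      by rewrite subv_add addvSl capvSl.
    rewrite subv_add addvSl; apply/subvP => u uU.
    have /memv_addP[a aA [b bB def_u]] := subvP (sU i) _ uU.
    rewrite def_u memv_add // memv_cap bB andbT.
    have -> : b = - a + u by rewrite def_u addKr.
    by rewrite memv_add // memvN.
  have capA : (A i :&: ((A i + U i) :&: B i) = 0)%VS.
    by apply/eqP; rewrite -subv0 -(AB0 i) capvS ?capvSr.
  have := dimv_sum_cap (A i) (U i).
  rewrite {1}eqAU (dimv_disjoint_sum capA) -addnA => /addnI <-.
  by rewrite addnC [(U i :&: A i)%VS]capvC.
rewrite -[leRHS]addr0 lerD //.
  by apply: sA => [|i]; [exact: invariant_cap|exact: capvSr].
apply: sB => [|i]; last exact: capvSr.
by apply: invariant_cap => //; apply: invariant_add.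
Qed.

Lemma semistable_in_sum mu f m (S : 'I_m -> family) :
  (forall k, stable_in mu f (S k)) ->
  (forall i, directv (\sum_(k < m) S k i)) ->
  semistable_in mu f (fun i => \sum_(k < m) S k i)%VS.
Proof.
move=> stS dS.
have dS' i : (\dim (\sum_(k < m) S k i) = \sum_(k < m) \dim (S k i))%N.
  exact: (directvP (dS i)).
elim: m S stS {dS} dS' => [|m IHm] S stS dS.
  move=> U _ sU; have/fdim_eq0 -> : forall i, U i = 0%VS; last by rewrite weight0.
  by move=> i; apply/eqP; have := sU i; rewrite big_ord0 subv0.
pose A i := (\sum_(k < m) S (widen_ord (leqnSn m) k) i)%VS.
have AB i : [/\ (\dim (A i) = \sum_(k < m) \dim (S (widen_ord (leqnSn m) k) i))%N
    & (A i :&: S ord_max i = 0)%VS].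
  (* The dimension of [A + S ord_max] attains the sum of all the dimensions, while that of [A] is at
     most the sum of the first [m]. The formula for sum and intersection then forces equality for
     [A] and a zero intersection. *)
  have := dS i; rewrite !big_ord_recr /= -/(A i) => dA.
  have leA : (\dim (A i) <= \sum_(k < m) \dim (S (widen_ord (leqnSn m) k) i))%N.
    exact: dimv_leq_sum.
  have cap := dimv_sum_cap (A i) (S ord_max i); split.
    apply/eqP; rewrite eqn_leq leA /= -(leq_add2r (\dim (S ord_max i))).
    by rewrite -dA -cap leq_addr.
  apply/eqP; rewrite -dimv_eq0 -leqn0.
  by rewrite -(leq_add2l (\dim (A i + S ord_max i))) cap dA addn0 leq_add2r.
have sA : semistable_in mu f A by apply: IHm => // i; case: (AB i).
have iA : invariant f A.
  move=> a u /memv_sumP[v vS ->]; rewrite linear_sum; apply: memv_sumr => k _.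
  by case: (stS (widen_ord (leqnSn m) k)) => iS _ _ _; apply/iS/vS.
have [iS _ _ _] := stS ord_max.
move=> U iU sU; apply: (semistable_in_add iA iS (fun i => proj2 (AB i)) sA) => //.
  exact: stable_in_semistable.
by move=> i; have := sU i; rewrite big_ord_recr.
Qed.

(** A nonzero invariant subfamily of weight 0 inside a semistable family is again semistable, so one
    can descend. When no proper one is left, every proper nonzero subfamily has negative weight. *)
Lemma exists_stable_in mu f W : invariant f W -> semistable_in mu f W ->
  fdim W != 0 -> weight Theta mu (fdim W) = 0 ->
  exists2 U, stable_in mu f U & forall i, (U i <= W i)%VS.
Proof.
have [N] := ubnP (total_dim (fdim W)); elim: N W => // N IHN W.
rewrite ltnS => leN iW sW Wn0 W0.
case: (EM (exists U, [/\ invariant f U, forall i, (U i <= W i)%VS, fdim U != 0,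
   exists i, U i != W i & weight Theta mu (fdim U) = 0])); last first.
  move=> noU; exists W => //; split=> // U iU sUW Un0 neU.
  rewrite lt_neqAle sW // andbT; apply/eqP => U0.
  by apply: noU; exists U.
move=> [U [iU sUW Un0 neU U0]].
have [] := IHN U _ iU _ Un0 U0.
- exact: leq_trans (total_fdim_lt sUW neU) leN.
- by move=> A iA sA; apply: sW => // i; apply: subv_trans (sA i) (sUW i).
by move=> A stA sA; exists A => // i; apply: subv_trans (sA i) (sUW i).
Qed.

(* The new maps are those of the associated graded representation of a
   Jordan-Hoelder filtration, realized on the same spaces by choosing
   complements; no quotient representation is needed. *)
Lemma jordan_holder mu f W : invariant f W -> semistable_in mu f W ->
  weight Theta mu (fdim W) = 0 ->
  exists (g : maps) (m : nat) (S : 'I_m -> family),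
    [/\ forall k, stable_in mu g (S k),
        forall i, (\sum_(k < m) S k i)%VS = W i
      & forall i, directv (\sum_(k < m) S k i)].
Proof.
have [N] := ubnP (total_dim (fdim W)); elim: N f W => // N IHN f W.
rewrite ltnS => leN iW sW W0.
have [/fdim_eq0 Wi0|Wn0] := eqVneq (fdim W) 0.
  exists f, 0%N, (fun=> W); split=> [[]//|i|i]; first by rewrite big_ord0 Wi0.
  by rewrite directvE /= !big_ord0 dimv0.
have [U stU sUW] := exists_stable_in iW sW Wn0 W0.
have [iU Un0 U0 _] := stU.
(* The complement [W'] stands for the quotient of [W] by [U]; its arrows [f1] are those of [f]
   followed by projection to [W'] along [U]. *)
pose W' i := (W i :\: U i)%VS.
have sW'W i : (W' i <= W i)%VS by apply: diffvSl.
have WU0 i : (W' i :&: U i = 0)%VS by apply: capv_diff.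
have UW0 i : (U i :&: W' i = 0)%VS by rewrite capvC.
have WUE i : (W' i + U i = W i)%VS by rewrite addv_diff; apply/addv_idPl.
pose f1 a := (daddv_pi (W' (tgt a)) (U (tgt a)) \o f a)%VF.
have sW' : semistable_in mu f1 W'.
  move=> A iA sA.
  (* The preimage of [A] under the quotient map is [A + U]. It is invariant under [f], and has the
     weight of [A] because [U] has weight 0. *)
  have : weight Theta mu (fdim (fun i => A i + U i)%VS) <= 0.
    apply: sW => [|i]; last by rewrite -WUE addvS.
    move=> a u /memv_addP[x xA [y yU ->]]; rewrite linearD /=.
    have xW : f a x \in (W' (tgt a) + U (tgt a))%VS.
      by rewrite WUE iW //; apply: (subvP (sW'W _)); apply: (subvP (sA _)).
    rewrite -(daddv_pi_add (WU0 _) xW) -addrA memv_add //.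
      by have := iA _ _ xA; rewrite comp_lfunE.
    by rewrite memvD ?memv_pi ?iU.
  rewrite (@weightD _ _ _ _ (fdim A) (fdim U)) ?U0 ?addr0 // => i.
  rewrite !ffunE dimv_disjoint_sum //.
  by apply/eqP; rewrite -subv0 -(WU0 i) capvS.
have W'0 : weight Theta mu (fdim W') = 0.
  have := @weightD _ Theta mu (fdim W) (fdim W') (fdim U); rewrite W0 U0 addr0.
  by move=> <- // i; rewrite !ffunE -dimv_disjoint_sum ?WUE.
have [||//|//|g [m [S [stS sumS dS]]]] := IHN f1 W'.
- apply: leq_trans leN; apply: total_fdim_lt => //.
  apply: contrapT => neW; case/eqP: Un0; apply/fdim_eq0 => i.
  case: (eqVneq (W' i) (W i)) => [eqW|ne]; last by case: neW; exists i.
  apply/eqP; rewrite -subv0 -(WU0 i) eqW subv_cap sUW /=; exact: subvv.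
- by move=> a u uW; rewrite comp_lfunE memv_pi.
have piWU i u : u \in U i -> daddv_pi (W' i) (U i) u = 0.
  move=> uU; have uWU : u \in (U i + W' i)%VS by rewrite (subvP (addvSl _ _)).
  have := daddv_pi_add (UW0 i) uWU; rewrite (daddv_pi_id (UW0 i) uU).
  by rewrite -[RHS]addr0 => /addrI.
have piUW i u : u \in W' i -> daddv_pi (U i) (W' i) u = 0.
  move=> uU; have uWU : u \in (W' i + U i)%VS by rewrite (subvP (addvSl _ _)).
  have := daddv_pi_add (WU0 i) uWU; rewrite (daddv_pi_id (WU0 i) uU).
  by rewrite -[RHS]addr0 => /addrI.
(* The direct sum of [f] on [U] and [g] on [W']: stability depends only on the maps on the family
   itself, so [U] and all [S k] remain stable for [h]. *)
pose h a := (f a \o daddv_pi (U (src a)) (W' (src a)))%VF +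
            (g a \o daddv_pi (W' (src a)) (U (src a)))%VF.
have hU a u : u \in U (src a) -> f a u = h a u.
  move=> uU; rewrite add_lfunE !comp_lfunE (daddv_pi_id (UW0 _) uU) piWU //.
  by rewrite linear0 addr0.
have hW a u : u \in W' (src a) -> g a u = h a u.
  move=> uW; rewrite add_lfunE !comp_lfunE (daddv_pi_id (WU0 _) uW) piUW //.
  by rewrite linear0 add0r.
pose S' k := oapp S U (unlift ord0 k).
have S'0 : S' ord0 = U by rewrite /S' unlift_none.
have S'S k : S' (lift ord0 k) = S k by rewrite /S' liftK.
have sumS' i : (\sum_(k < m) S' (lift ord0 k) i = W' i)%VS.
  by rewrite -sumS; apply: eq_bigr => k _; rewrite S'S.
exists h, m.+1, S'; split=> [k|i|i].
- case: (unliftP ord0 k) => [j|] ->; rewrite ?S'0 ?S'S.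
    apply: eq_stable_in (stS j) => a u uS; apply: hW.
    by rewrite -sumS (subvP (sumv_sup j _ (subvv _))).
  exact: eq_stable_in stU.
- by rewrite big_ord_recl S'0 sumS' addvC.
rewrite directvE /= !big_ord_recl S'0 sumS' dimv_disjoint_sum // eqn_add2l.
have := dS i; rewrite directvE /= sumS => /eqP ->.
by apply/eqP/eq_bigr => k _; rewrite S'S.
Qed.

End Families.

(** * Translation between subrepresentations and invariant families *)

Section Representations.
Variables (F : fieldType) (Q : quiver) (Theta : stability Q) (X : rep F Q).

Lemma rdim_rep_of_subrep (U : subrep X) : rdim (rep_of_subrep U) = fdim U.
Proof. by apply/ffunP => i; rewrite !ffunE dimvf. Qed.

Lemma subrep_invariant (U : subrep X) : invariant (@rmap _ _ X) U.
Proof. by apply/invariantP => a; apply: sspaceP. Qed.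

Definition subrep_of_invariant (U : forall i, {vspace rspace X i})
  (iU : invariant (@rmap _ _ X) U) : subrep X :=
  Subrep (proj2 (invariantP _ _) iU).

Lemma stableP : stable Theta X <-> rdim X != 0 /\
  forall U, invariant (@rmap _ _ X) U -> fdim U != 0 ->
    (exists i, U i != fullv) -> slope Theta (fdim U) < slope Theta (rdim X).
Proof.
rewrite /stable /nonzero_rep /rslope; split=> -[Xn0 sX]; split=> // U.
  by move=> iU; have := sX (subrep_of_invariant iU); rewrite rdim_rep_of_subrep.
by rewrite rdim_rep_of_subrep; apply/sX/subrep_invariant.
Qed.

End Representations.

Section Subrepresentations.
Variables (F : fieldType) (Q : quiver) (Theta : stability Q) (X : rep F Q).

Lemma subrep_img (U : subrep X) (A : forall i, {vspace subvs_of (U i)}) :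
  invariant (@rmap _ _ (rep_of_subrep U)) A <->
  invariant (@rmap _ _ X) (fun i => linfun (@vsval _ _ (U i)) @: A i)%VS.
Proof.
have Umap a (u : subvs_of (U (src a))) :
    rmap X a (vsval u) = vsval (@rmap _ _ (rep_of_subrep U) a u).
  by rewrite !comp_lfunE !lfunE /= vsprojK // subrep_invariant ?subvsP.
split=> iA a u.
  case/memv_imgP => v vA ->; rewrite lfunE /= Umap -[vsval _]lfunE memv_img //.
  exact: iA.
move=> uA; have := iA a _ (memv_img (linfun vsval) uA).
by rewrite lfunE /= Umap => /memv_imgP[w wA]; rewrite (lfunE _ w) => /subvs_inj ->.
Qed.

Lemma fdim_subrep_img (U : subrep X) (A : forall i, {vspace subvs_of (U i)}) :
  fdim (fun i => linfun (@vsval _ _ (U i)) @: A i)%VS = fdim A.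
Proof.
apply/ffunP => i; rewrite !ffunE limg_dim_eq //.
apply/eqP; rewrite -subv0; apply/subvP => u; rewrite memv_cap memv_ker lfunE /=.
by case/andP => _ /eqP u0; rewrite memv0; apply/eqP/subvs_inj; rewrite u0.
Qed.

Lemma subrep_img_full (U : subrep X) i :
  (linfun (@vsval _ _ (U i)) @: fullv = U i)%VS.
Proof.
apply/eqP; rewrite eqEdim; apply/andP; split.
  by apply/subvP => _ /memv_imgP[u _ ->]; rewrite lfunE subvsP.
have /ffunP/(_ i) := fdim_subrep_img (fun i => fullv : {vspace subvs_of (U i)}).
by rewrite !ffunE => ->; rewrite dimvf.
Qed.

(** The inclusion of [U] into [X] identifies subrepresentations of [U] with invariant families of
    [X] contained in [U], preserving dimensions. Intrinsic stability of [U] thus becomes a condition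
    inside [X]. *)
Lemma stable_subrepP mu (U : subrep X) :
  stable Theta (rep_of_subrep U) /\ rslope Theta (rep_of_subrep U) = mu <->
  stable_in Theta mu (@rmap _ _ X) U.
Proof.
rewrite /stable_in; split=> [[/stableP[]]|[_ Un0 U0 sU]].
  rewrite /rslope rdim_rep_of_subrep => Un0 sU defmu; split=> //.
  - exact: subrep_invariant.
  - by apply/eqP; rewrite -slope_eq // defmu.
  move=> A iA sA An0 [i neA].
  (* The family [A] lies in [U], so [B] is the same family seen in the spaces of
     [rep_of_subrep U]. *)
  pose B i := (linfun (@vsproj _ _ (U i)) @: A i)%VS.
  have AB j : (linfun (@vsval _ _ (U j)) @: B j = A j)%VS.
    rewrite /B -limg_comp; apply/eqP; rewrite eqEsubv.
    have id_on u : u \in A j -> u = (linfun (@vsval _ _ (U j)) \o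
        linfun (@vsproj _ _ (U j)))%VF u.
      by move=> uA; rewrite comp_lfunE !lfunE /= vsprojK // (subvP (sA j)).
    apply/andP; split; apply/subvP => u.
      by case/memv_imgP => v vA ->; rewrite -id_on.
    by move=> uA; rewrite (id_on u uA) memv_img.
  have dimB : fdim A = fdim B.
    by rewrite -fdim_subrep_img; apply/ffunP => j; rewrite !ffunE AB.
  rewrite dimB -slope_lt -?dimB // dimB -defmu; apply: sU.
  - apply/subrep_img => a u; rewrite !AB; exact: iA.
  - by rewrite -dimB.
  exists i; apply: contraNneq neA => Bi.
  by rewrite -AB Bi subrep_img_full.
have defmu : rslope Theta (rep_of_subrep U) = mu.
  by rewrite /rslope rdim_rep_of_subrep; apply/eqP; rewrite slope_eq // U0.
split=> //; apply/stableP; rewrite -/(rslope _ _) defmu rdim_rep_of_subrep.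
split=> // A iA An0 [i neA]; rewrite slope_lt // -fdim_subrep_img.
apply: sU; first exact/subrep_img.
- by move=> j; apply: subv_trans (limgS _ (subvf _)) _; rewrite subrep_img_full.
- by rewrite fdim_subrep_img.
exists i; apply: contraNneq neA => Ai; rewrite eqEdim subvf dimvf /=.
have /ffunP/(_ i) := fdim_subrep_img A.
by rewrite !ffunE Ai => <-.
Qed.

End Subrepresentations.

(** * Polystable and semistable representations *)

Lemma polystable_semistable (F : fieldType) (Q : quiver) (Theta : stability Q)
    (X : rep F Q) : polystable Theta X ->
  semistable_in Theta (slope Theta (rdim X)) (@rmap _ _ X) (fun=> fullv).
Proof.
case=> Xn0 [m [U [stU slU sumU dU]]].
have [mu stmu] : exists mu, forall k, stable_in Theta mu (@rmap _ _ X) (U k).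
  (* Without summands the condition is vacuous and any [mu] will do; 0 is taken. *)
  case: m U stU slU {sumU dU} => [|m] U stU slU; first by exists 0; case.
  exists (rslope Theta (rep_of_subrep (U ord0))) => k.
  by apply/stable_subrepP; split.
have sX : semistable_in Theta mu (@rmap _ _ X) (fun=> fullv).
  move=> A iA _; apply: (semistable_in_sum stmu dU iA) => i.
  by rewrite sumU subvf.
suff -> : slope Theta (rdim X) = mu by [].
(* The common slope of the summands is that of [X], since the weight of [X] is the sum of their
   weights, all 0. *)
apply/eqP; rewrite slope_eq // /weight /theta.
have dimX i : rdim X i = (\sum_(k < m) \dim (U k i))%N.
  by rewrite ffunE -sumU; apply: (directvP (dU i)).
under eq_bigr do rewrite dimX natr_sum mulr_sumr.
rewrite exchange_big big1 //= => k _; have [_ _ Uk0 _] := stmu k.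
by rewrite -[RHS]Uk0; apply: eq_bigr => i _; rewrite ffunE.
Qed.

(** The associated graded representation of a Jordan-Hoelder filtration lives on the spaces of [X],
    hence has the same dimension vector. *)
Lemma semistable_polystable (F : fieldType) (Q : quiver) (Theta : stability Q)
    (X : rep F Q) : rdim X != 0 ->
  semistable_in Theta (slope Theta (rdim X)) (@rmap _ _ X) (fun=> fullv) ->
  exists Y : rep F Q, polystable Theta Y /\ rdim Y = rdim X.
Proof.
move=> Xn0 sX.
have [||g [m [S [stS sumS dS]]]] := jordan_holder _ sX.
- by move=> a u _; rewrite memvf.
- exact: weight_slope.
exists (Rep g); split=> //; split=> //.
have iS k : invariant (@rmap _ _ (Rep g)) (S k) by case: (stS k).
exists m, (fun k => subrep_of_invariant (iS k)).
have st k := proj2 (@stable_subrepP _ _ Theta (Rep g) _ (subrep_of_invariant (iS k))) (stS k).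
split=> // [k|k l]; first by case: (st k).
by rewrite (proj2 (st k)) (proj2 (st l)).
Qed.


(** * Restricting and constructing framed representations *)

Section ScaleVector.
Variables (F : fieldType) (V : vectType F) (v : V).

Definition scale_vector (t : F^o) : V := (t : F) *: v.

Fact scale_vector_is_linear : linear scale_vector.
Proof. by move=> a s t; rewrite /scale_vector scalerDl scalerA. Qed.

HB.instance Definition _ :=
  GRing.isLinear.Build F F^o V _ scale_vector scale_vector_is_linear.

End ScaleVector.

Section Framing.
Variables (F : fieldType) (Q : quiver) (Theta : stability Q) (d n : dimvec Q).
Variable eps : rat.
Notation hTheta := (hat_theta n Theta d eps).

(** The dimension vectors of subrepresentations that vanish at infinity. *)
Definition zero_ext (e : dimvec Q) : dimvec (hat_quiver n) :=
  [ffun o : option (vertex Q) => if o is Some i then e i else 0%N].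

Lemma slope_zero_ext (e : dimvec Q) : slope hTheta (zero_ext e) = slope Theta e.
Proof.
rewrite /slope /theta /total_dim !big_option /= !ffunE mulr0 add0r add0n.
by congr (_ / _%:R); apply: eq_bigr => i _; rewrite !ffunE.
Qed.

Lemma zero_ext_eq0 (e : dimvec Q) : (zero_ext e == 0) = (e == 0).
Proof.
apply/eqP/eqP => [/ffunP e0|->]; apply/ffunP => i.
  by have := e0 (Some i); rewrite !ffunE.
by rewrite !ffunE; case: i => // i; rewrite ffunE.
Qed.

Lemma slope_hat_dim : d != 0 ->
  slope hTheta (hat_dim n d) = slope Theta d + eps / (total_dim d).+1%:R.
Proof.
move=> d0; have := weight_slope Theta d0; rewrite weightE => /eqP.
rewrite subr_eq0 => /eqP thetad.
have totalE : total_dim (hat_dim n d) = (total_dim d).+1.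
  rewrite /total_dim big_option /= ffunE add1n; congr _.+1.
  by apply: eq_bigr => i _; rewrite ffunE.
(* Here [theta Theta d] is [slope Theta d] times [total_dim d], and the vertex infinity contributes
   [slope Theta d + eps]. *)
have thetaE : theta hTheta (hat_dim n d) =
    slope Theta d * (total_dim d).+1%:R + eps.
  rewrite -natr1 mulrDr mulr1 -thetad -addrA addrC /theta big_option /= ffunE mulr1.
  by congr (_ + _); apply: eq_bigr => i _; rewrite ffunE.
by rewrite {1}/slope totalE thetaE mulrDl mulfK // pnatr_eq0.
Qed.

Lemma fdim_zero_ext (X : rep F (hat_quiver n))
    (U : forall o, {vspace rspace X o}) : U None = 0%VS ->
  fdim U = zero_ext (fdim (fun i => U (Some i))).
Proof.
by move=> U0; apply/ffunP; case=> [i|]; rewrite !ffunE // U0 dimv0.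
Qed.

Definition restriction (X : rep F (hat_quiver n)) : rep F Q :=
  @Rep F Q (fun i => rspace X (Some i)) (fun a => @rmap _ _ X (inl a)).

Lemma restriction_dim (X : rep F (hat_quiver n)) :
  rdim X = hat_dim n d -> rdim (restriction X) = d.
Proof.
by move/ffunP => dX; apply/ffunP => i; have := dX (Some i); rewrite !ffunE.
Qed.

Lemma restriction_semistable (X : rep F (hat_quiver n)) : d != 0 -> 0 < eps ->
  (forall e : dimvec Q, (forall i, e i <= d i)%N ->
     slope Theta d < slope Theta e -> eps < slope Theta e - slope Theta d) ->
  rdim X = hat_dim n d -> stable hTheta X ->
  semistable_in Theta (slope Theta d) (@rmap _ _ (restriction X)) (fun=> fullv).
Proof.
move=> d0 eps0 gap dX /stableP[_ stX] U iU _.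
have [->|Un0] := eqVneq (fdim U) 0; first by rewrite weight0.
rewrite -slope_le // leNgt; apply/negP => ltU.
(* Added arrows start at infinity, so extending a destabilizing [U] by 0 there keeps it
   invariant. *)
pose Uh (o : vertex (hat_quiver n)) : {vspace rspace X o} :=
  match o with Some i => U i | None => 0%VS end.
have iUh : invariant (@rmap _ _ X) Uh.
  case=> [a|p] u /=; first exact: iU.
  by rewrite memv0 => /eqP->; rewrite linear0 mem0v.
have dUh : fdim Uh = zero_ext (fdim U) by apply: fdim_zero_ext.
have := stX _ iUh; rewrite dUh zero_ext_eq0 slope_zero_ext dX slope_hat_dim //.
move=> /(_ Un0) lt_slope.
have {}lt_slope : slope Theta (fdim U) - slope Theta d < eps.
  rewrite ltrBlDl; apply: lt_le_trans (lt_slope _) _; last first.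
    by rewrite lerD2l ler_piMr ?(ltW eps0) // invf_le1 ?ler1n ?ltr0n.
  (* The extension is proper because [X] has dimension 1 at infinity. *)
  exists None; rewrite eq_sym -dimv_eq0.
  by have /ffunP/(_ None) := dX; rewrite !ffunE => ->.
have le_Ud i : (fdim U i <= d i)%N.
  by rewrite -(restriction_dim dX) !ffunE dimvS ?subvf.
by have := lt_trans lt_slope (gap _ le_Ud ltU); rewrite ltxx.
Qed.

Definition framing_space (X : rep F Q) (o : option (vertex Q)) : vectType F :=
  if o is Some i then rspace X i else F^o.

(* The arrows infinity -> i send 1 to the vectors of a basis of X_i, padded
   with zeros. *)
Definition framing_map (X : rep F Q) (a : arrow (hat_quiver n)) :
    'Hom(framing_space X (src a), framing_space X (tgt a)) :=
  match a with
  | inl b => @rmap _ _ X b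
  | inr p => linfun (scale_vector (vbasis {: rspace X (tag p)})`_(tagged p))
  end.

Definition framing (X : rep F Q) : rep F (hat_quiver n) := Rep (framing_map X).

Lemma framing_dim (X : rep F Q) : rdim X = d -> rdim (framing X) = hat_dim n d.
Proof.
move/ffunP => dX; apply/ffunP; case=> [i|]; rewrite !ffunE.
  by rewrite -dX ffunE.
by rewrite dimvf.
Qed.

Lemma framing_stable (X : rep F Q) : d != 0 -> 0 < eps ->
  (forall i, d i <= n i)%N -> rdim X = d ->
  semistable_in Theta (slope Theta d) (@rmap _ _ X) (fun=> fullv) ->
  stable hTheta (framing X).
Proof.
move=> d0 eps0 le_dn dX sX; apply/stableP; rewrite (framing_dim dX).
split=> [|U iU Un0 [o neU]].
  by apply/eqP => /ffunP/(_ None); rewrite !ffunE.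
have [U0|UN0] := eqVneq (U None) 0%VS.
  rewrite slope_hat_dim // (fdim_zero_ext U0) slope_zero_ext.
  move: Un0; rewrite (fdim_zero_ext U0) zero_ext_eq0 => Un0.
  rewrite ltr_pwDr ?divr_gt0 ?ltr0n //.
  rewrite slope_le //; apply: sX => [a u uU|i]; last exact: subvf.
  exact: (iU (inl a)).
(* A nonzero subspace of the line [F^o] contains 1: rescale any nonzero element. *)
have U1 : (1 : F^o) \in U None.
  have t0 : vpick (U None) != 0 by rewrite vpick0.
  rewrite -(@mulVf F (vpick (U None))) //.
  by have := memvZ (vpick (U None) : F)^-1 (memv_pick (U None)).
case/eqP: neU; apply/eqP; rewrite eqEsubv subvf /=.
case: o => [i|]; last first.
  apply/subvP => t _; have := memvZ (t : F) U1.
  by rewrite /GRing.scale /= mulr1.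
rewrite -(span_basis (vbasisP (@fullv _ (rspace X i)))); apply/span_subvP => v.
case/(nthP 0) => k; rewrite size_tuple => ltk <-.
(* As [n i] is at least [d i], the [k]-th basis vector has its own arrow from infinity, which sends
   1 to it. *)
have ltkn : (k < n i)%N.
  apply: leq_trans ltk (leq_trans _ (le_dn i)).
  by rewrite -dX ffunE.
have := iU (inr (Tagged (fun i => 'I_(n i)) (Ordinal ltkn))) _ U1.
by rewrite /= lfunE /= /scale_vector scale1r.
Qed.

End Framing.

(** * The bound on epsilon and the equivalence *)

Lemma slope_gap (Q : quiver) (Theta : stability Q) (d : dimvec Q) :
  exists2 eps0 : rat, 0 < eps0 & forall e : dimvec Q, (forall i, e i <= d i)%N ->
    slope Theta d < slope Theta e -> eps0 <= slope Theta e - slope Theta d.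
Proof.
(* Each entry of a vector [e] below [d] is at most [total_dim d], so all such vectors come from one
   finite type of functions. *)
pose dim_of (g : {ffun vertex Q -> 'I_(total_dim d).+1}) : dimvec Q :=
  [ffun i => g i : nat].
have [eps0 eps0_gt0 gap] := exists_gap
  [seq slope Theta (dim_of g) - slope Theta d | g in predT].
exists eps0 => // e le_ed lt_de; apply: gap; last by rewrite subr_gt0.
apply/imageP; exists [ffun i => inord (e i)] => //.
congr (slope _ _ - _); apply/ffunP => i; rewrite !ffunE inordK // ltnS.
by apply: leq_trans (le_ed i) _; rewrite /total_dim (bigD1 i) //= leq_addr.
Qed.

(** Sufficiently small is made precise by a bound [eps0] chosen from [Theta] and [d] alone, hence
    uniform in [n]. *)
Theorem lemma3p7 (R : realType) (Q : quiver) (Theta : stability Q)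
    (d : dimvec Q) (hd : d != 0) :
  exists eps0 : rat, 0 < eps0 /\
    forall eps : rat, 0 < eps -> eps < eps0 ->
    forall n : dimvec Q, (forall i : vertex Q, (d i <= n i)%N) ->
      (nonempty (smooth_model R[i] Theta d n eps) <->
       nonempty (moduli_sst R[i] Theta d)).
Proof.
have [eps0 eps0_gt0 gap] := slope_gap Theta d.
exists eps0; split=> // eps eps_gt0 lt_eps n le_dn; split.
  case=> _ [X [stX dX _]].
  have dY := restriction_dim dX.
  have sY : semistable_in Theta (slope Theta (rdim (restriction X)))
      (@rmap _ _ (restriction X)) (fun=> fullv).
    rewrite dY; apply: restriction_semistable dX stX => // e le_ed lt_de.
    exact: lt_le_trans lt_eps (gap e le_ed lt_de).
  have [|Z [polyZ dZ]] := semistable_polystable _ sY; first by rewrite dY.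
  by exists (iso_class Z), Z; rewrite dZ dY.
case=> _ [X [polyX dX _]]; exists (iso_class (framing n X)), (framing n X).
split=> //; last exact: framing_dim.
apply: framing_stable => //; rewrite -dX; exact: polystable_semistable.
Qed.
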